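(* Let $\mathcal M^0_*$ denote the set of pointed-isometry classes of boundedly-compact pointed metric spaces, and let $d_{GH}$ be the restriction of $d_{GHP}$ to $\mathcal M^0_*$ (each pointed metric space $(X,o)$ being identified with the pmm space $(X,o,0)$ with the zero measure). Then $d_{GH}$ is a metrization of the Gromov-Hausdorff topology on $\mathcal M^0_*$: for boundedly-compact pointed metric spaces $\mathcal X_n,\mathcal X$, one has $d_{GH}(\mathcal X_n,\mathcal X)\to0$ if and only if $\mathcal X_n$ converges to $\mathcal X$ in the Gromov-Hausdorff sense. Moreover, $(\mathcal M^0_*,d_{GH})$ is a complete separable metric space.
   Context: A pointed measured metric (pmm) space is $\mathcal X=(X,o,\mu)$ with $X$ a metric space, $o\in X$, $\mu$ a nonnegative Borel measure; compact if $X$ compact and $\mu$ finite; boundedly compact if closed balls $\overline B_r(x)$ are compact and have finite measure. $\overline B_r(\mathcal X):=(\overline B_r(o),o,\mu|_{\overline B_r(o)})$. A pointed isometry between pointed metric spaces $(X,o)$, $(X',o')$ is a surjective distance-preserving map sending $o$ to $o'$. $d_H$: Hausdorff distance; $d_P$: Prokhorov distance ($d_P(\mu,\nu)=\inf\{\epsilon>0:\mu(A)\le\nu(A^\epsilon)+\epsilon,\ \nu(A)\le\mu(A^\epsilon)+\epsilon\ \forall A\text{ closed}\}$, $A^\epsilon$ the closed $\epsilon$-neighborhood). For compact pmm spaces, $d^c_{GHP}(\mathcal X,\mathcal Y)=\inf\{d(f(o_X),g(o_Y))\vee d_H(f(X),g(Y))\vee d_P(f_*\mu_X,g_*\mu_Y)\}$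 over metric spaces $Z$ and isometric embeddings $f:X\to Z$, $g:Y\to Z$. $\mathcal X'=(X',o',\mu')\preceq\mathcal X$ means $X'\subseteq X$, $o'=o$, $\mu'\le\mu$. For $r\ge\epsilon\ge0$, $a(\epsilon,r;\mathcal X,\mathcal Y):=\inf d^c_{GHP}(\overline B_r(\mathcal X),\mathcal Y')$ over compact pmm-subspaces $\mathcal Y'$ with $\overline B_{r-\epsilon}(\mathcal Y)\preceq\mathcal Y'\preceq\mathcal Y$; $a_\epsilon:=a(\epsilon,1/\epsilon;\cdot,\cdot)$; $d_{GHP}(\mathcal X,\mathcal Y):=\inf\{\epsilon\in(0,1]:a_\epsilon(\mathcal X,\mathcal Y)\vee a_\epsilon(\mathcal Y,\mathcal X)<\epsilon/2\}$, $\inf\emptyset:=1$. Gromov-Hausdorff convergence: boundedly-compact pointed metric spaces $\mathcal X_n$ converge to $\mathcal X$ in the Gromov-Hausdorff sense if for every $r>0$ and $0<\epsilon\le r$, $\lim_n a(\epsilon,r;\mathcal X_n,\mathcal X)=0$, where $a$ is computed by equipping all spaces with zero measures. *)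

(* Defs.v *)
From HB Require Import structures.
From mathcomp Require Import all_boot all_order all_algebra.
From mathcomp Require Import all_classical all_reals all_analysis.
From Stdlib Require List.
Set Implicit Arguments. Unset Strict Implicit. Unset Printing Implicit Defensive.
Import Order.TTheory GRing.Theory Num.Theory numFieldNormedType.Exports.
Local Open Scope classical_set_scope.
Local Open Scope ring_scope.

Section GHP.
Variable R : realType.

Record metricSpace := MetricSpace {
  msT :> Type;
  mdist : msT -> msT -> R;
  mdist_self : forall x, mdist x x = 0;
  mdist_sym : forall x y, mdist x y = mdist y x;
  mdist_tri : forall x y z, mdist x z <= mdist x y + mdist y z;
  mdist_sep : forall x y, mdist x y = 0 -> x = y }.

Record pmetricSpace := PMetricSpace { pms :> metricSpace; pt : pms }.

Definition cball (X : metricSpace) (x : X) (r : R) : set X :=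
  [set y | mdist x y <= r].

(** Closed epsilon-neighbourhood A^eps = {z | dist(z, A) <= eps}. *)
Definition cnbhd (X : metricSpace) (A : set X) (e : R) : set X :=
  [set z | forall d, 0 < d -> exists2 a, A a & mdist z a < e + d].

Definition mopen (X : metricSpace) (U : set X) :=
  forall x, U x -> exists2 e, 0 < e & forall y, mdist x y < e -> U y.
Definition mclosed (X : metricSpace) (A : set X) := cnbhd A 0 `<=` A.
Definition mcompact (X : metricSpace) (K : set X) :=
  forall (I : Type) (U : I -> set X), (forall i, mopen (U i)) ->
    (forall x, K x -> exists i, U i x) ->
    exists s : seq I, forall x, K x -> exists i, List.In i s /\ U i x.

Definition bcompact (X : metricSpace) :=
  forall (x : X) (r : R), mcompact (cball x r).

Definition isom_on (X Z : metricSpace) (K : set X) (f : X -> Z) :=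
  forall x y, K x -> K y -> mdist (f x) (f y) = mdist x y.
Definition pointed_isometric (X Y : pmetricSpace) :=
  exists phi : X -> Y, [/\ (forall x y, mdist (phi x) (phi y) = mdist x y),
                          (forall y, exists x, phi x = y) &
                          phi (pt X) = pt Y].

Definition hausdorff (Z : metricSpace) (A B : set Z) : R :=
  inf [set e | 0 < e /\ A `<=` cnbhd B e /\ B `<=` cnbhd A e].

(** Finite (real-valued) measures are represented by their values on sets.
    Prokhorov distance. *)
Definition prokhorov (Z : metricSpace) (mu nu : set Z -> R) : R :=
  inf [set e | 0 < e /\ forall A : set Z, mclosed A ->
         mu A <= nu (cnbhd A e) + e /\ nu A <= mu (cnbhd A e) + e].

Definition pushK (X Z : metricSpace) (K : set X) (f : X -> Z) (mu : set X -> R)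
  : set Z -> R := fun A => mu (K `&` f @^-1` A).

Definition restr (X : metricSpace) (K : set X) (mu : set X -> R) : set X -> R :=
  fun A => mu (A `&` K).

Definition zero_meas (X : metricSpace) : set X -> R := fun _ => 0.

(** Compact GHP distance between the compact pmm spaces (K, o, mu|_K)
    (subspace of X) and (L, o', nu|_L) (subspace of Y). *)
Definition dGHPc (X Y : metricSpace) (K : set X) (o : X) (mu : set X -> R)
    (L : set Y) (o' : Y) (nu : set Y -> R) : R :=
  inf [set t | exists (Z : metricSpace) (f : X -> Z) (g : Y -> Z),
         isom_on K f /\ isom_on L g /\
         t = Num.max (mdist (f o) (g o'))
               (Num.max (hausdorff (f @` K) (g @` L))
                        (prokhorov (pushK K f mu) (pushK L g nu)))].

(** a(eps, r; X, Y) for pmm spaces X = (X, o, mu), Y = (Y, o', nu). The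
    compact pmm-subspaces Y' = (L, o', nu') with
    Bbar_{r-eps}(Y) <= Y' <= Y. *)
Definition a_GHP (eps r : R) (X : metricSpace) (o : X) (mu : set X -> R)
    (Y : metricSpace) (o' : Y) (nu : set Y -> R) : R :=
  inf [set t | exists (L : set Y) (nu' : set Y -> R),
         [/\ mcompact L, cball o' (r - eps) `<=` L,
             (forall A, nu' A = nu' (A `&` L)),
             (forall A, restr (cball o' (r - eps)) nu A <= nu' A) &
             (forall A, nu' A <= nu A)] /\
             t = dGHPc (cball o r) o (restr (cball o r) mu) L o' nu'].

Definition a_eps (eps : R) (X : metricSpace) (o : X) (mu : set X -> R)
    (Y : metricSpace) (o' : Y) (nu : set Y -> R) : R :=
  a_GHP eps eps^-1 o mu o' nu.

Definition dGHP (X : metricSpace) (o : X) (mu : set X -> R)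
    (Y : metricSpace) (o' : Y) (nu : set Y -> R) : R :=
  let S := [set e | 0 < e /\ e <= 1 /\
              Num.max (a_eps e o mu o' nu) (a_eps e o' nu o mu) < e / 2] in
  if pselect (S = set0) then 1 else inf S.

Definition dGH (X Y : pmetricSpace) : R :=
  dGHP (pt X) (@zero_meas X) (pt Y) (@zero_meas Y).

Definition a_GH (eps r : R) (X Y : pmetricSpace) : R :=
  a_GHP eps r (pt X) (@zero_meas X) (pt Y) (@zero_meas Y).

Definition GH_converges (Xs : nat -> pmetricSpace) (X : pmetricSpace) :=
  forall r eps : R, 0 < r -> 0 < eps -> eps <= r ->
    a_GH eps r (Xs n) X @[n --> \oo] --> (0 : R).

End GHP.

(* Main.v *)
From Pilot Require Import Defs.
From HB Require Import structures.
From mathcomp Require Import all_boot all_order all_algebra.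
From mathcomp Require Import all_classical all_reals all_analysis.
From mathcomp Require Import ring lra.
(* Again, since MathComp-Analysis shadows [mdist]. *)
Import Pilot.Defs.
Import Order.TTheory GRing.Theory Num.Theory numFieldNormedType.Exports.
Local Open Scope classical_set_scope.
Local Open Scope ring_scope.
Set Implicit Arguments. Unset Strict Implicit. Unset Printing Implicit Defensive.

(** Over zero measures, [a(eps, r; X, Y) < t] says that some correspondence
    containing the pair of base points is defined on the whole ball
    [B_r(X)], reaches the whole ball [B_(r - eps)(Y)] and has distortion less
    than [2 t]: a correspondence is read off a common embedding, and conversely
    [X + Y] is metrized by shortest paths through the correspondence. In these
    terms the triangle inequality is composition of correspondences, with
    [1/(a+b) + a <= 1/b] taking care of the radii. Limits along an ultrafilter of
    finer and finer correspondences give an isometry when [dGH X Y = 0]. A Cauchy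
    sequence converges to the completion of its ultralimit. For separability, two
    spaces whose balls have fine nets with the same rounded distance matrices
    are close. *)

(** * Compactness and limits along ultrafilters in metric spaces *)

Lemma mdist_ge0 (R : realType) (X : metricSpace R) (x y : X) : 0 <= mdist x y.
Proof.
by have := mdist_tri x y x; rewrite mdist_self (mdist_sym y x) => ?; lra.
Qed.

Lemma inf_ge0 (R : realType) (E : set R) : lbound E 0 -> 0 <= inf E.
Proof.
move=> E0; have [->|/set0P En0] := eqVneq E set0; first by rewrite inf0.
exact: lb_le_inf.
Qed.

Lemma inf_le_mem (R : realType) (E : set R) (x : R) :
  lbound E 0 -> E x -> inf E <= x.
Proof. by move=> E0 Ex; apply: ge_inf => //; exists 0. Qed.

Lemma mopen_ball (R : realType) (X : metricSpace R) (a : X) (r : R) :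
  mopen [set y | mdist a y < r].
Proof.
move=> x /= ax; exists (r - mdist a x); first by rewrite subr_gt0.
by move=> y /= xy; have := mdist_tri a x y; lra.
Qed.

Lemma mcompact_bounded (R : realType) (X : metricSpace R) (K : set X) (a : X) :
  mcompact K -> exists M : R, forall x, K x -> mdist a x <= M.
Proof.
move=> cK.
have [//|x _|s sK] := cK nat (fun n => [set y | mdist a y < n%:R]).
- by move=> n; exact: mopen_ball.
- by exists (Num.truncn (mdist a x)).+1; exact: truncnS_gt.
have [M HM] : exists M : R, forall n, List.In n s -> n%:R <= M.
  elim: s {sK} => [|n s [M HM]]; first by exists 0.
  exists (Num.max n%:R M) => k [<-|/HM kM]; first by rewrite le_max lexx.
  by rewrite le_max kM orbT.
exists M => x /sK[n [/HM nM /= xn]]; lra.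
Qed.

(** A cover of [L] becomes one of [K] once the open complement of [L], indexed by [None], is
    added. *)
Lemma mcompact_closed (R : realType) (X : metricSpace R) (K L : set X) :
  mcompact K -> mclosed L -> L `<=` K -> mcompact L.
Proof.
move=> cK cL LK I U oU LU.
have [||s sK] := cK (option I) (fun i => if i is Some j then U j else ~` L).
- move=> [j|]; first exact: oU.
  move=> x /= nLx; apply: contrapT => H; apply/nLx/cL => d d0.
  apply: contrapT => H2; apply: H; exists d => // y xy Ly.
  by apply: H2; exists y => //; rewrite add0r.
- move=> x Kx; have [/LU[i Ui]|nLx] := pselect (L x); first by exists (Some i).
  by exists None.
exists (pmap id s) => x Lx; have [[j|] [js Ux]] := sK _ (LK _ Lx) => //.
exists j; split=> //; elim: s js {sK} => //= -[i|] s IH /= [] //.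
- by case=> ->; left.
- by move=> /IH; right.
Qed.

Lemma mcompact_net (R : realType) (X : metricSpace R) (K : set X) (e : R) :
  mcompact K -> 0 < e ->
  exists s : seq X, forall x, K x -> exists a, List.In a s /\ mdist a x < e.
Proof.
move=> cK e0; apply: (cK X (fun a => [set y | mdist a y < e])).
- by move=> a; exact: mopen_ball.
- by move=> x _; exists x; rewrite /= mdist_self.
Qed.

Lemma cnbhd0_closed (R : realType) (X : metricSpace R) (A : set X) :
  mclosed (cnbhd A 0).
Proof.
move=> x xA d d0; have [|y yA xy] := xA (d / 2); first lra.
have [|z Az yz] := yA (d / 2); first lra.
by exists z => //; have := mdist_tri x y z; lra.
Qed.

(** With [f = id] this is convergence of a filter on [X] itself. *)
Definition ulim (R : realType) (I : Type) (F : set_system I) (X : metricSpace R)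
    (f : I -> X) (x : X) :=
  forall e : R, 0 < e -> F [set i | mdist (f i) x < e].

(** If no point of [K] were a limit, each would have a ball with preimage outside [F]. Finitely many
    such balls cover [K], and an ultrafilter containing a finite union contains one of its
    members. *)
Lemma mcompact_ulim (R : realType) (I : Type) (F : set_system I)
    (X : metricSpace R) (K : set X) (f : I -> X) :
  UltraFilter F -> mcompact K -> F (f @^-1` K) ->
  exists2 x, K x & ulim F f x.
Proof.
move=> UF cK FK; apply: contrapT => H.
have {}H x : K x -> exists2 e : R, 0 < e & ~ F [set i | mdist (f i) x < e].
  move=> Kx; apply: contrapT => H2; apply: H; exists x => // e e0.
  by apply: contrapT => H3; apply: H2; exists e.
pose J := {p : X * R | 0 < p.2 /\ ~ F [set i | mdist (f i) p.1 < p.2]}.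
have [||s sK] := cK J (fun j => [set y | mdist (sval j).1 y < (sval j).2]).
- by move=> j; exact: mopen_ball.
- move=> x Kx; have [e e0 He] := H _ Kx.
  by exists (exist _ (x, e) (conj e0 He)); rewrite /= mdist_self.
have : F (f @^-1` [set y | exists j, List.In j s /\
    mdist (sval j).1 y < (sval j).2]) by apply: filterS FK => i /sK.
elim: s {sK} => [|j s IH] FA.
  have : F set0 by apply: filterS FA => i /= [j []].
  exact: filter_not_empty.
have [FB|FB] := in_ultra_setVsetC [set i | mdist (f i) (sval j).1 < (sval j).2] UF.
  exact: (svalP j).2 FB.
apply: IH; apply: filterS2 FA FB => i /= [k [[<-|ks] ik]] nij.
  by case: nij; rewrite mdist_sym.
by exists k.
Qed.

(** Without a finite subcover, the parts [B s] of [K] missed by finite subfamilies generate a proper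
    filter. A limit of a finer ultrafilter [G] lies in some [U i], and then [G] contains both [U i]
    and the disjoint set [B [:: i]]. *)
Lemma ulim_mcompact (R : realType) (X : metricSpace R) (K : set X) :
  (forall F : set_system X, UltraFilter F -> F K ->
     exists2 x, K x & ulim F id x) -> mcompact K.
Proof.
move=> H I U oU KU; apply: contrapT => nfin.
pose B (s : seq I) := K `\` [set x | exists i, List.In i s /\ U i x].
have PF : ProperFilter (filter_from setT B).
  apply: filter_from_proper.
    apply: filter_from_filter; first by exists [::].
    move=> s t _ _; exists (s ++ t) => // x [Kx nst].
    split; split=> //= -[i [it Ui]]; apply: nst; exists i; split=> //;
      apply/List.in_or_app; tauto.
  move=> s _; apply: contrapT => Bs; apply: nfin; exists s => x Kx.
  by apply: contrapT => Hx; apply: Bs; exists x.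
have [G [UG FG]] := ultraFilterLemma PF.
have GK : G K by apply: FG; exists [::] => // x [].
have [x Kx Gx] := H G UG GK.
have [i Ui] := KU x Kx; have [e e0 He] := oU i x Ui.
have GU : G (U i).
  by apply: filterS (Gx _ e0) => y /= yx; apply: He; rewrite mdist_sym.
have GB : G (B [:: i]) by apply: FG; exists [:: i].
have [y [Uy [_ []]]] := filter_ex (filterI GU GB).
by exists i; split=> //; left.
Qed.

Lemma ultra_real_cvg (R : realType) (I : Type) (F : set_system I) (f : I -> R)
    (M : R) :
  UltraFilter F -> F [set i | `|f i| <= M] ->
  exists l : R, forall e, 0 < e -> F [set i | `|f i - l| < e].
Proof.
move=> UF FM.
have [|l [_ cl]] := (@segment_compact R (- M) M (f @ F) _ _).
  change (F (f @^-1` `[- M, M])).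
  by apply: filterS FM => i; rewrite /= ler_norml in_itv.
exists l => e e0; have [//|FN] := in_ultra_setVsetC [set i | `|f i - l| < e] UF.
have [] := cl (~` ball l e) (ball l e).
- change (F (f @^-1` (~` ball l e))).
  by apply: filterS FN => i /= nfi; rewrite /ball/= distrC.
- exact: nbhsx_ballx.
- by move=> x [].
Qed.

(** * Gluing along a correspondence *)

(** The length of a shortest path from [X] to [Y] that crosses once, at cost [h], through a related
    pair. *)
Definition cross_dist (R : realType) (X Y : metricSpace R) (C : X -> Y -> Prop)
    (h : R) (x : X) (y : Y) : R :=
  inf [set t | exists a b, C a b /\ t = mdist x a + h + mdist b y].

Definition glue_dist (R : realType) (X Y : metricSpace R) (C : X -> Y -> Prop)
    (h : R) (u v : X + Y) : R :=
  match u, v with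
  | inl x, inl x' => mdist x x'
  | inr y, inr y' => mdist y y'
  | inl x, inr y => cross_dist C h x y
  | inr y, inl x => cross_dist C h x y
  end.

Definition distortion_le (R : realType) (X Y : metricSpace R)
    (C : X -> Y -> Prop) (d : R) :=
  forall x y x' y', C x y -> C x' y' ->
    mdist x x' <= mdist y y' + d /\ mdist y y' <= mdist x x' + d.

Lemma cross_dist_le (R : realType) (X Y : metricSpace R) (C : X -> Y -> Prop)
    (h : R) (x a : X) (y b : Y) :
  0 <= h -> C a b -> cross_dist C h x y <= mdist x a + h + mdist b y.
Proof.
move=> h0 Cab; apply: inf_le_mem; last by exists a, b.
by move=> _ [a' [b' [_ ->]]]; rewrite !addr_ge0 ?mdist_ge0.
Qed.

Lemma cross_dist_ge (R : realType) (X Y : metricSpace R) (C : X -> Y -> Prop)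
    (h c : R) (x : X) (y : Y) :
  (exists a b, C a b) ->
  (forall a b, C a b -> c <= mdist x a + h + mdist b y) ->
  c <= cross_dist C h x y.
Proof.
move=> [a [b Cab]] H; apply: lb_le_inf; first by eexists; exists a, b.
by move=> _ [a' [b' [Cab' ->]]]; exact: H.
Qed.

Lemma cross_dist_tril (R : realType) (X Y : metricSpace R) (C : X -> Y -> Prop)
    (h : R) (x x' : X) (y : Y) :
  0 <= h -> (exists a b, C a b) ->
  cross_dist C h x y <= mdist x x' + cross_dist C h x' y.
Proof.
move=> h0 Cn0; rewrite -lerBlDl; apply: cross_dist_ge => // a b Cab.
by have := cross_dist_le x y h0 Cab; have := mdist_tri x x' a; lra.
Qed.

Lemma cross_dist_trir (R : realType) (X Y : metricSpace R) (C : X -> Y -> Prop)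
    (h : R) (x : X) (y y' : Y) :
  0 <= h -> (exists a b, C a b) ->
  cross_dist C h x y <= cross_dist C h x y' + mdist y y'.
Proof.
move=> h0 Cn0; rewrite -lerBlDr; apply: cross_dist_ge => // a b Cab.
have := cross_dist_le x y h0 Cab; have := mdist_tri b y' y.
by rewrite (mdist_sym y'); lra.
Qed.

(** A detour through [Y] crosses twice and so costs [2 * h], at least as much as the distortion can
    save. *)
Lemma cross_dist_XX (R : realType) (X Y : metricSpace R) (C : X -> Y -> Prop)
    (h : R) (x x' : X) (y : Y) :
  0 <= h -> (exists a b, C a b) -> distortion_le C (2 * h) ->
  mdist x x' <= cross_dist C h x y + cross_dist C h x' y.
Proof.
move=> h0 Cn0 Ch; rewrite -lerBlDr; apply: cross_dist_ge => // a b Cab.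
rewrite lerBlDr -lerBlDl; apply: cross_dist_ge => // a' b' Cab'.
have [+ _] := Ch _ _ _ _ Cab Cab'.
have := mdist_tri x a x'; have := mdist_tri a a' x'; have := mdist_tri b y b'.
by rewrite (mdist_sym y b') (mdist_sym a' x'); lra.
Qed.

Lemma cross_dist_YY (R : realType) (X Y : metricSpace R) (C : X -> Y -> Prop)
    (h : R) (x : X) (y y' : Y) :
  0 <= h -> (exists a b, C a b) -> distortion_le C (2 * h) ->
  mdist y y' <= cross_dist C h x y + cross_dist C h x y'.
Proof.
move=> h0 Cn0 Ch; rewrite -lerBlDr; apply: cross_dist_ge => // a b Cab.
rewrite lerBlDr -lerBlDl; apply: cross_dist_ge => // a' b' Cab'.
have [_] := Ch _ _ _ _ Cab Cab'.
have := mdist_tri y b y'; have := mdist_tri b b' y'; have := mdist_tri a x a'.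
by rewrite (mdist_sym a x) (mdist_sym y b); lra.
Qed.

Lemma cross_dist_gt0 (R : realType) (X Y : metricSpace R) (C : X -> Y -> Prop)
    (h : R) (x : X) (y : Y) :
  0 < h -> (exists a b, C a b) -> 0 < cross_dist C h x y.
Proof.
move=> h0 Cn0; apply: (lt_le_trans h0); apply: cross_dist_ge => // a b _.
by have := mdist_ge0 x a; have := mdist_ge0 b y; lra.
Qed.

(** The four mixed triangle inequalities are the lemmas on [cross_dist]; [0 < h] keeps the two
    copies apart, so that distinct points have positive distance. *)
Lemma glue_space (R : realType) (X Y : metricSpace R) (C : X -> Y -> Prop)
    (h : R) :
  0 < h -> (exists a b, C a b) -> distortion_le C (2 * h) ->
  exists (Z : metricSpace R) (f : X -> Z) (g : Y -> Z),
    [/\ forall x x', mdist (f x) (f x') = mdist x x',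
        forall y y', mdist (g y) (g y') = mdist y y' &
        forall x y, C x y -> mdist (f x) (g y) <= h].
Proof.
move=> h0 Cn0 Ch; have h0' := ltW h0.
have self u : glue_dist C h u u = 0 by case: u => ?; exact: mdist_self.
have sym u v : glue_dist C h u v = glue_dist C h v u.
  by case: u v => ? [?|?] //=; exact: mdist_sym.
have tri u v w : glue_dist C h u w <= glue_dist C h u v + glue_dist C h v w.
  case: u v w => u [v|v] [w|w] /=; try exact: mdist_tri.
  - exact: cross_dist_tril.
  - exact: cross_dist_XX.
  - by rewrite (mdist_sym v); exact: cross_dist_trir.
  - by rewrite addrC (mdist_sym v); exact: cross_dist_tril.
  - exact: cross_dist_YY.
  - by rewrite addrC; exact: cross_dist_trir.
have sep u v : glue_dist C h u v = 0 -> u = v.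
  case: u v => u [v|v] /= uv; try by rewrite (mdist_sep uv).
  - by have := cross_dist_gt0 u v h0 Cn0; rewrite uv ltxx.
  - by have := cross_dist_gt0 v u h0 Cn0; rewrite uv ltxx.
exists (MetricSpace self sym tri sep), inl, inr; split=> // x y Cxy /=.
by have := cross_dist_le x y h0' Cxy; rewrite !mdist_self addr0 add0r.
Qed.

(** * Approximation by correspondences and the quantity [a_GH] *)

(** The two radii are independent, so that approximations can be reversed and composed. [C] may
    leave the balls: a partner of a point of the [r]-ball is only known to lie in the ball of radius
    [r + d]. *)
Definition approx (R : realType) (X Y : pmetricSpace R) (r s d : R) :=
  exists C : X -> Y -> Prop,
    [/\ C (pt X) (pt Y),
        forall x, cball (pt X) r x -> exists y, C x y,
        forall y, cball (pt Y) s y -> exists x, C x y &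
        distortion_le C d].

Lemma approx_sym (R : realType) (X Y : pmetricSpace R) (r s d : R) :
  approx X Y r s d -> approx Y X s r d.
Proof.
move=> [C [Cpt Cl Cr Cd]]; exists (fun y x => C x y); split=> //.
by move=> y x y' x' Cxy Cxy'; have [? ?] := Cd _ _ _ _ Cxy Cxy'.
Qed.

Lemma approxW (R : realType) (X Y : pmetricSpace R) (r s d r' s' d' : R) :
  r' <= r -> s' <= s -> d <= d' -> approx X Y r s d -> approx X Y r' s' d'.
Proof.
move=> rr ss dd [C [Cpt Cl Cr Cd]]; exists C; split=> //.
- by move=> x xr; apply: Cl; exact: le_trans xr rr.
- by move=> x xr; apply: Cr; exact: le_trans xr ss.
- by move=> x y x' y' Cxy Cxy'; have [? ?] := Cd _ _ _ _ Cxy Cxy'; split; lra.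
Qed.

Lemma approx_ge0 (R : realType) (X Y : pmetricSpace R) (r s d : R) :
  approx X Y r s d -> 0 <= d.
Proof.
by move=> [C [Cpt _ _ /(_ _ _ _ _ Cpt Cpt)[]]]; rewrite !mdist_self add0r.
Qed.

Lemma dGHPc_ge0 (R : realType) (X Y : metricSpace R) (K : set X) (o : X)
    (mu : set X -> R) (L : set Y) (o' : Y) (nu : set Y -> R) :
  0 <= dGHPc K o mu L o' nu.
Proof.
by apply: inf_ge0 => _ [Z [f [g [_ [_ ->]]]]]; rewrite le_max mdist_ge0.
Qed.

Lemma cball_center (R : realType) (X : metricSpace R) (o : X) (r : R) :
  0 <= r -> cball o r o.
Proof. by rewrite /cball /= mdist_self. Qed.

(** In a nearly optimal common space [Z], points at distance at most [m] are related. The bound [M]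
    ensures that the Hausdorff distance is an infimum over a nonempty set. *)
Lemma dGHPc_lt (R : realType) (X Y : metricSpace R) (K : set X) (o : X)
    (mu : set X -> R) (L : set Y) (o' : Y) (nu : set Y -> R) (M t : R) :
  K o -> L o' -> (forall x, K x -> mdist o x <= M) ->
  (forall y, L y -> mdist o' y <= M) -> dGHPc K o mu L o' nu < t ->
  exists C : X -> Y -> Prop, exists2 d : R, d < 2 * t &
    [/\ C o o', forall x, K x -> exists2 y, L y & C x y,
        forall y, L y -> exists2 x, K x & C x y & distortion_le C d].
Proof.
move=> Ko Lo' KM LM /inf_lt[].
  (* [inf_lt] asks for some common embedding to exist: gluing at the base points alone provides
     one. *)
  have [|||Z [f [g [fi gi _]]]] :=
    @glue_space R X Y (fun x y => x = o /\ y = o') 1.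
  - exact: ltr01.
  - by exists o, o'.
  - by move=> x y x' y' [-> ->] [-> ->]; rewrite !mdist_self; split; lra.
  by eexists; exists Z, f, g; split; [|split; last reflexivity];
    move=> *; rewrite ?fi ?gi.
move=> _ [Z [f [g [fi [gi ->]]]]]; rewrite !gt_max => /and3P[oo' + _].
move=> /inf_lt[].
  (* Each point is within [M] of its own base point, hence within [mdist (f o) (g o') + M] of the
     other one; the 1 makes the radius positive. *)
  exists (mdist (f o) (g o') + M + 1); split; last split.
  - have := mdist_ge0 (f o) (g o'); have := KM _ Ko.
    by rewrite mdist_self; lra.
  - move=> _ [x Kx <-] d d0; exists (g o'); first by exists o'.
    have := mdist_tri (f x) (f o) (g o'); rewrite fi// (mdist_sym x).
    by have := KM _ Kx; lra.
  - move=> _ [y Ly <-] d d0; exists (f o); first by exists o.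
    have := mdist_tri (g y) (g o') (f o); rewrite gi// (mdist_sym y).
    by have := LM _ Ly; rewrite (mdist_sym (g o')); lra.
move=> e [e0 [KL LK]] et.
(* [m > e] absorbs the slack in [cnbhd], and [m < t] gives a distortion [2 * m] below [2 * t]. *)
pose m := (Num.max (mdist (f o) (g o')) e + t) / 2.
have [m1 [m2 mt]] : mdist (f o) (g o') <= m /\ e < m /\ m < t.
  have : mdist (f o) (g o') <= Num.max (mdist (f o) (g o')) e.
    by rewrite le_max lexx.
  have : e <= Num.max (mdist (f o) (g o')) e by rewrite le_max lexx orbT.
  have : Num.max (mdist (f o) (g o')) e < t by rewrite gt_max oo'.
  by rewrite /m; move: (Num.max _ _) => M'; split; [|split]; lra.
exists (fun x y => [/\ K x, L y & mdist (f x) (g y) <= m]); exists (2 * m); first lra.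
split=> //.
- move=> x Kx; have [|_ [y Ly <-] xy] := KL _ (imageP f Kx) (m - e).
    by lra.
  by exists y => //; split=> //; lra.
- move=> y Ly; have [|_ [x Kx <-] xy] := LK _ (imageP g Ly) (m - e).
    by lra.
  by exists x => //; split=> //; rewrite mdist_sym; lra.
move=> x y x' y' [Kx Ly xy] [Kx' Ly' xy'].
rewrite -(fi x x')// -(gi y y')//; split.
  have := mdist_tri (f x) (g y) (f x'); have := mdist_tri (g y) (g y') (f x').
  by rewrite (mdist_sym (g y') (f x')); lra.
have := mdist_tri (g y) (f x) (g y'); have := mdist_tri (f x) (f x') (g y').
by rewrite (mdist_sym (g y) (f x)); lra.
Qed.

(** In the glued space related points are within [h], which bounds the base point and Hausdorff
    terms. Between zero measures every positive number is admissible for the Prokhorov distance, in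
    particular [h]. *)
Lemma dGHPc_zero_le (R : realType) (X Y : metricSpace R) (K : set X) (o : X)
    (L : set Y) (o' : Y) (C : X -> Y -> Prop) (h : R) :
  0 < h -> C o o' -> (forall x, K x -> exists2 y, L y & C x y) ->
  (forall y, L y -> exists2 x, K x & C x y) -> distortion_le C (2 * h) ->
  dGHPc K o (@zero_meas R X) L o' (@zero_meas R Y) <= h.
Proof.
move=> h0 Coo Cl Cr Cd.
have [//||//|Z [f [g [fi gi fg]]]] := @glue_space R X Y C h.
  by exists o, o'.
apply: (@le_trans _ _ (Num.max (mdist (f o) (g o'))
  (Num.max (hausdorff (f @` K) (g @` L))
     (prokhorov (pushK K f (@zero_meas R X)) (pushK L g (@zero_meas R Y)))))).
  apply: inf_le_mem.
    by move=> _ [Z' [f' [g' [_ [_ ->]]]]]; rewrite le_max mdist_ge0.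
  by exists Z, f, g; split; [|split=> //]; move=> *; rewrite ?fi ?gi.
rewrite !ge_max fg//=; apply/andP; split; apply: inf_le_mem.
- by move=> e [/ltW].
- split=> //; split=> _ [z Hz <-] d d0.
    have [y Ly Cxy] := Cl _ Hz; exists (g y); first by exists y.
    by have := fg _ _ Cxy; lra.
  have [x Kx Cxy] := Cr _ Hz; exists (f x); first by exists x.
  by have := fg _ _ Cxy; rewrite mdist_sym; lra.
- by move=> e [/ltW].
- by split=> // A _; rewrite /pushK /zero_meas; split; lra.
Qed.

Lemma a_GH_lt_approx (R : realType) (X Y : pmetricSpace R) (e r t : R) :
  bcompact X -> bcompact Y -> 0 < e -> e <= r -> a_GH e r X Y < t ->
  exists2 d : R, d < 2 * t & approx X Y r (r - e) d.
Proof.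
move=> cX cY e0 er /inf_lt[].
  (* The ball itself with zero measure is an admissible subspace, so the infimum is over a nonempty
     set. *)
  eexists; exists (cball (pt Y) (r - e)), (@zero_meas R Y).
  by split; last reflexivity; split.
move=> _ [L [nu [[cL BL _ _ _] ->]]].
have [M HM] := mcompact_bounded (pt Y) cL.
move=> lt_t.
have [||||C [d dt [Coo Cl Cr Cd]]] := dGHPc_lt (M := Num.max r M) _ _ _ _ lt_t.
- by apply: cball_center; lra.
- by apply: BL; apply: cball_center; lra.
- by move=> x xr; rewrite le_max xr.
- by move=> y /HM yM; rewrite le_max yM orbT.
exists d => //; exists C; split=> //.
  by move=> x /Cl[y _ Cxy]; exists y.
by move=> y /BL /Cr[x _ Cxy]; exists x.
Qed.

(* [L] is the closure of the image of the ball, so that it is compact; the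
   correspondence is thickened by [n] in order to reach all of it. *)
Lemma approx_a_GH_lt (R : realType) (X Y : pmetricSpace R) (e r t d : R) :
  bcompact Y -> 0 <= r -> d <= e -> d < 2 * t -> approx X Y r (r - e) d ->
  a_GH e r X Y < t.
Proof.
move=> cY r0 de dt apXY; have d0 := approx_ge0 apXY.
case: apXY => C [Coo Cl Cr Cd].
(* Thickening by [n] raises the distortion from [d] to [d + 2 * n = 2 * h]; a quarter of the
   available slack keeps [h < t]. *)
pose n := (2 * t - d) / 4; pose h := d / 2 + n.
have n0 : 0 < n by rewrite /n; lra.
have h0 : 0 < h by rewrite /h; lra.
have ht : h < t by rewrite /h /n; lra.
pose A := [set y | exists2 x, cball (pt X) r x & C x y].
pose L := cnbhd A 0.
have AL : A `<=` L.
  by move=> y Ay z z0; exists y => //; rewrite mdist_self add0r.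
have cL : mcompact L.
  apply: (@mcompact_closed _ _ (cball (pt Y) (r + d + 1))); first exact: cY.
    exact: cnbhd0_closed.
  move=> y /(_ 1 ltr01)[z [x xr Cxz]]; rewrite add0r => yz.
  have [_] := Cd _ _ _ _ Coo Cxz; have := mdist_tri (pt Y) z y.
  by rewrite (mdist_sym z); move: xr; rewrite /cball/=; lra.
apply: le_lt_trans ht.
apply: (@le_trans _ _ (dGHPc (cball (pt X) r) (pt X) (@zero_meas R X)
   L (pt Y) (@zero_meas R Y))).
  apply: inf_le_mem.
    by move=> _ [L' [nu [_ ->]]]; exact: dGHPc_ge0.
  exists L, (@zero_meas R Y); split=> //; split=> // y yr; apply: AL.
  (* The partner [x] is at distance at most [r - e + d] from the base point, hence at most [r] by
     [d <= e]. *)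
  have [x Cxy] := Cr _ yr; exists x => //.
  by have [+ _] := Cd _ _ _ _ Coo Cxy; move: yr; rewrite /cball/=; lra.
pose C' x y := [/\ cball (pt X) r x, L y & exists2 z, C x z & mdist y z <= n].
apply: (@dGHPc_zero_le _ _ _ _ _ _ _ C') => //.
- split; first exact: cball_center.
    by apply: AL; exists (pt X) => //; exact: cball_center.
  by exists (pt Y) => //; rewrite mdist_self ltW.
- move=> x xr; have [y Cxy] := Cl _ xr.
  have Ly : L y by apply: AL; exists x.
  by exists y => //; split=> //; exists y => //; rewrite mdist_self ltW.
- move=> y Ly; have [z [x xr Cxz] yz] := Ly _ n0.
  by exists x => //; split=> //; exists z => //; rewrite add0r in yz; lra.
move=> x y x' y' [_ _ [z Cxz yz]] [_ _ [z' Cxz' yz']].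
have [H1 H2] := Cd _ _ _ _ Cxz Cxz'.
have := mdist_tri y z y'; have := mdist_tri z z' y'.
have := mdist_tri z y z'; have := mdist_tri y y' z'.
by rewrite (mdist_sym z' y') (mdist_sym z y) /h; split; lra.
Qed.

(** * The distance [dGH] in terms of correspondences *)

Lemma dGH_ge0 (R : realType) (X Y : pmetricSpace R) : 0 <= dGH X Y.
Proof.
rewrite /dGH /dGHP; case: pselect => /= [S0|Sn0]; first exact: ler01.
by apply: inf_ge0 => e [/ltW].
Qed.

Lemma dGH_sym (R : realType) (X Y : pmetricSpace R) : dGH X Y = dGH Y X.
Proof.
pose S (X Y : pmetricSpace R) := [set e : R | 0 < e /\ e <= 1 /\
  Num.max (a_GH e e^-1 X Y) (a_GH e e^-1 Y X) < e / 2].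
have dE Z W : dGH Z W = if pselect (S Z W = set0) then 1 else inf (S Z W) by [].
rewrite !dE; suff -> : S X Y = S Y X by [].
by apply/seteqP; split=> e [e0 [e1 em]]; do 2!split=> //; rewrite maxC.
Qed.

Lemma dGH_le1 (R : realType) (X Y : pmetricSpace R) : dGH X Y <= 1.
Proof.
rewrite /dGH /dGHP; case: pselect => /= [//|] /eqP/set0P[e Se].
apply: (@le_trans _ _ e); last by case: Se => _ [].
by apply: inf_le_mem => // t [/ltW].
Qed.

(** Some [e' < e] is admissible, and passing from [e'] to [e] shrinks both radii. The opposite
    direction is obtained through [dGH_sym]. *)
Lemma dGH_lt_approx (R : realType) (X Y : pmetricSpace R) (e : R) :
  bcompact X -> bcompact Y -> e <= 1 -> dGH X Y < e ->
  exists2 d : R, d < e & approx X Y e^-1 (e^-1 - e) d.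
Proof.
(* The default value 1 of the empty case is excluded by [e <= 1]. *)
move=> cX cY e1; rewrite /dGH /dGHP; case: pselect => /= [S0 ?|]; first lra.
move=> /eqP/set0P Sn0 /(inf_lt Sn0)[e' [e'0 [e'1]]].
rewrite gt_max => /andP[+ _] e'e => /a_GH_lt_approx[]//.
  by rewrite (le_trans e'1)// invf_ge1.
move=> d; rewrite mulrC divfK// => de' ap; exists d; first exact: lt_trans e'e.
have ee : e^-1 <= e'^-1 by rewrite lef_pV2 ?posrE ?ltW// (lt_trans e'0).
by apply: approxW ap => //; lra.
Qed.

Lemma approx_dGH_le (R : realType) (X Y : pmetricSpace R) (e d d' : R) :
  bcompact X -> bcompact Y -> 0 < e -> e <= 1 -> d < e -> d' < e ->
  approx X Y e^-1 (e^-1 - e) d -> approx Y X e^-1 (e^-1 - e) d' -> dGH X Y <= e.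
Proof.
move=> cX cY e0 e1 de d'e aXY aYX; rewrite /dGH /dGHP.
have ei : 0 <= e^-1 by rewrite invr_ge0 ltW.
have Se : [set e | 0 < e /\ e <= 1 /\ Num.max
      (a_eps e (pt X) (@zero_meas R X) (pt Y) (@zero_meas R Y))
      (a_eps e (pt Y) (@zero_meas R Y) (pt X) (@zero_meas R X)) < e / 2] e.
  do 2!split=> //; rewrite gt_max.
  apply/andP; split; [apply: approx_a_GH_lt aXY|apply: approx_a_GH_lt aYX] => //.
  - exact: ltW.
  - by rewrite mulrC divfK.
  - exact: ltW.
  - by rewrite mulrC divfK.
case: pselect => /= [S0|Sn0]; first by move: Se; rewrite S0.
by apply: inf_le_mem Se => t [/ltW].
Qed.

(** A relation reaching the full radius on both sides also serves, reversed, for the other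
    direction. *)
Lemma approx_dGH_le_balanced (R : realType) (X Y : pmetricSpace R) (e d : R) :
  bcompact X -> bcompact Y -> 0 < e -> e <= 1 -> d < e ->
  approx X Y e^-1 e^-1 d -> dGH X Y <= e.
Proof.
move=> cX cY e0 e1 de ap.
by apply: (approx_dGH_le cX cY e0 e1 de de);
  [|move/approx_sym in ap]; apply: approxW ap => //; lra.
Qed.

(** * Composition and the triangle inequality *)

(** Partners of points of the [v]-ball lie in the ball of radius [v + d], where the second relation
    has to be defined; likewise backwards from the [w]-ball. *)
Lemma approx_comp (R : realType) (X Y W : pmetricSpace R) (r s t u v w d d' : R) :
  approx X Y r s d -> approx Y W t u d' ->
  v <= r -> v + d <= t -> w <= u -> w + d' <= s -> approx X W v w (d + d').
Proof.
move=> [C [Coo Cl Cr Cd]] [C' [Coo' Cl' Cr' Cd']] vr vt wu ws.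
exists (fun x z => exists2 y, C x y & C' y z); split.
- by exists (pt Y).
- move=> x xv; have [|y Cxy] := Cl x; first exact: le_trans xv vr.
  have [|z Cyz] := Cl' y; last by exists z, y.
  by have [_] := Cd _ _ _ _ Coo Cxy; move: xv; rewrite /cball/=; lra.
- move=> z zw; have [|y Cyz] := Cr' z; first exact: le_trans zw wu.
  have [|x Cxy] := Cr y; last by exists x, y.
  by have [+ _] := Cd' _ _ _ _ Coo' Cyz; move: zw; rewrite /cball/=; lra.
- move=> x z x' z' [y xy yz] [y' xy' yz'].
  by have [? ?] := Cd _ _ _ _ xy xy'; have [? ?] := Cd' _ _ _ _ yz yz'; split; lra.
Qed.

Lemma inv_addr_le (R : realType) (a b : R) :
  0 < a -> 0 < b -> a + b <= 1 -> (a + b)^-1 + a <= b^-1.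
Proof.
move=> a0 b0 ab1; have ab0 : 0 < a + b by lra.
rewrite -subr_ge0.
have -> : b^-1 - ((a + b)^-1 + a) = a * (1 - b * (a + b)) / (b * (a + b)).
  by field; rewrite !gt_eqF.
apply: divr_ge0; last by rewrite mulr_ge0// ltW.
by rewrite mulr_ge0 ?ltW// subr_gt0; nra.
Qed.

Lemma dGH_triangle (R : realType) (X Y W : pmetricSpace R) :
  bcompact X -> bcompact Y -> bcompact W ->
  dGH X W <= dGH X Y + dGH Y W.
Proof.
move=> cX cY cW; apply/ler_addgt0Pr => t t0.
pose a := dGH X Y + t / 2; pose b := dGH Y W + t / 2.
have Xa := dGH_ge0 X Y; have Yb := dGH_ge0 Y W.
have -> : dGH X Y + dGH Y W + t = a + b by rewrite /a /b; lra.
(* As [dGH] never exceeds 1, only the case [a + b <= 1] needs an argument. *)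
have [/ltW ?|ab1] := ltP 1 (a + b); first exact: le_trans (dGH_le1 _ _) _.
have a0 : 0 < a by rewrite /a; lra.
have b0 : 0 < b by rewrite /b; lra.
have XYa : dGH X Y < a by rewrite /a; lra.
have YWb : dGH Y W < b by rewrite /b; lra.
have ia := inv_addr_le a0 b0 ab1.
have ib : (a + b)^-1 + b <= a^-1 
  by rewrite addrC (addrC a) addrC inv_addr_le// addrC.
have [|d1 d1a XY] := dGH_lt_approx cX cY _ XYa; first lra.
have [|d2 d2b YW] := dGH_lt_approx cY cW _ YWb; first lra.
(* [dGH] asks for both directions: [XY] is composed with [YW], and [WY] with [YX]. *)
have [||d3 d3a YX] := @dGH_lt_approx _ _ _ a cY cX.
- by lra.
- by rewrite dGH_sym.
have [||d4 d4b WY] := @dGH_lt_approx _ _ _ b cW cY.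
- by lra.
- by rewrite dGH_sym.
apply: (@approx_dGH_le _ _ _ _ (d1 + d2) (d4 + d3)) => //; try lra.
- by apply: (approx_comp XY YW); lra.
- by apply: (approx_comp WY YX); lra.
Qed.

(** * Comparison with Gromov-Hausdorff convergence *)

Lemma cvg0_nonneg (R : realType) (u : nat -> R) :
  (forall n, 0 <= u n) ->
  (u n @[n --> \oo] --> (0 : R)) <->
  (forall e, 0 < e -> exists N : nat, forall n, (N <= n)%N -> u n < e).
Proof.
move=> u0; rewrite cvgrPdist_lt; split=> H e e0.
  have [N _ HN] := H e e0; exists N => n Nn.
  by have := HN n Nn; rewrite /= sub0r normrN ger0_norm.
by have [N HN] := H e e0; exists N => // n /HN; rewrite /= sub0r normrN ger0_norm.
Qed.

Lemma a_GH_ge0 (R : realType) (X Y : pmetricSpace R) (e r : R) :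
  0 <= a_GH e r X Y.
Proof. by apply: inf_ge0 => _ [L [nu [_ ->]]]; exact: dGHPc_ge0. Qed.

Lemma dGH_cvg (R : realType) (Xs : nat -> pmetricSpace R) (X : pmetricSpace R) :
  (forall n, bcompact (Xs n)) -> bcompact X ->
  (dGH (Xs n) X @[n --> \oo] --> (0 : R)) <-> GH_converges Xs X.
Proof.
move=> cXs cX; rewrite cvg0_nonneg; last by move=> n; exact: dGH_ge0.
split=> [H r eps r0 eps0 epsr|H e e0].
  apply/cvg0_nonneg => [n|t t0]; first exact: a_GH_ge0.
  (* These bounds give [r <= e^-1 - e], which covers both radii, and a distortion at most [eps] and
     below [2 * t]. *)
  pose e := Num.min (Num.min (r + 1)^-1 1) (Num.min eps t).
  have i0 : 0 < (r + 1)^-1 by rewrite invr_gt0; lra.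
  have e0 : 0 < e by rewrite !lt_min i0 ltr01 eps0.
  have [er [e1 [eeps et]]] : e <= (r + 1)^-1 /\ e <= 1 /\ e <= eps /\ e <= t.
    by rewrite /e !ge_min !lexx !orbT.
  have ri : r + 1 <= e^-1 by rewrite -[r + 1]invrK lef_pV2 ?posrE.
  have [N HN] := H e e0; exists N => n /HN.
  move=> /dGH_lt_approx[]// d de ap.
  by apply: (@approx_a_GH_lt _ _ _ _ _ _ d) => //;
    [exact: ltW|lra|lra|apply: approxW ap; lra].
have [e' [e'0 e'1 e'e]] : exists e', [/\ 0 < e', e' <= 1 & e' < e].
  exists (Num.min 1 (e / 2)); rewrite lt_min ltr01 divr_gt0// ge_min lexx.
  by split=> //; rewrite gt_min; apply/orP; right; lra.
have i0 : 0 < e'^-1 by rewrite invr_gt0.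
(* At radius [e'^-1 + e'] the smaller ball still has radius [e'^-1], so the balanced criterion
   applies. *)
have [||N HN] := (cvg0_nonneg (fun n => a_GH_ge0 (Xs n) X e' (e'^-1 + e'))).1 _ (e' / 2).
- by apply: H => //; lra.
- by lra.
exists N => n /HN; apply: (fun P Q => le_lt_trans (P Q) e'e).
move=> /a_GH_lt_approx[]//; first lra.
move=> d dt ap; apply: (@approx_dGH_le_balanced _ _ _ _ d) => //; first lra.
by apply: approxW ap; lra.
Qed.

(** * Limits of correspondences along an ultrafilter *)

(** The family [B] is dependent, so that points can be chosen in all the spaces [Xs n] at once. *)
Lemma ex_choice (A : Type) (B : A -> Type) (P : forall a, B a -> Prop) :
  (forall x, exists y, P x y) -> exists f : forall a, B a, forall x, P x (f x).
Proof. by move=> H; exists (fun a => sval (cid (H a))) => x; exact: svalP. Qed.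

Lemma ulim_const (R : realType) (I : Type) (F : set_system I)
    (X : metricSpace R) (x : X) : ProperFilter F -> ulim F (fun=> x) x.
Proof. by move=> FF e e0; apply: filterE => i; rewrite /= mdist_self. Qed.

Lemma exists_nat_ultrafilter :
  exists2 U : set_system nat, UltraFilter U &
    forall N : nat, U [set n | (N <= n)%N].
Proof.
have [U [UU sU]] := ultraFilterLemma (F := \oo) _.
by exists U => // N; apply: sU; exists N.
Qed.

Lemma ulim_dist_eq (R : realType) (U : set_system nat) (X Y : metricSpace R)
    (f g : nat -> X) (f' g' : nat -> Y) (x y : X) (x' y' : Y) :
  ProperFilter U -> (forall N : nat, U [set n | (N <= n)%N]) ->
  ulim U f x -> ulim U g y -> ulim U f' x' -> ulim U g' y' ->
  U [set n | mdist (f n) (g n) <= mdist (f' n) (g' n) + n.+1%:R^-1 /\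
             mdist (f' n) (g' n) <= mdist (f n) (g n) + n.+1%:R^-1] ->
  mdist x y = mdist x' y'.
Proof.
move=> UU Uoo fx gy fx' gy' UH; apply/eqP; rewrite eq_le.
suff H e : 0 < e -> mdist x y <= mdist x' y' + e /\ mdist x' y' <= mdist x y + e.
  by apply/andP; split; apply/ler_addgt0Pr => e /H[].
(* Four approximations of limits and the discrepancy [n.+1%:R^-1] cost [e / 5] each. *)
move=> e0; have e5 : 0 < e / 5 by lra.
pose N := Num.truncn (e / 5)^-1.
have := filter_ex (filterI (filterI (filterI (fx _ e5) (gy _ e5))
  (filterI (fx' _ e5) (gy' _ e5))) (filterI UH (Uoo N))).
move=> [n /= [[[h1 h2] [h3 h4]] [[h5 h6] h7]]].
have h8 : n.+1%:R^-1 <= e / 5.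
  rewrite -[e / 5]invrK lef_pV2 ?posrE ?invr_gt0//.
  apply/ltW/(lt_le_trans (truncnS_gt _)).
  by rewrite ler_nat ltnS.
have := mdist_tri x (f n) y; have := mdist_tri (f n) (g n) y.
have := mdist_tri x' (f' n) y'; have := mdist_tri (f' n) (g' n) y'.
have := mdist_tri (f n) x (g n); have := mdist_tri x y (g n).
have := mdist_tri (f' n) x' (g' n); have := mdist_tri x' y' (g' n).
rewrite (mdist_sym x (f n)) (mdist_sym x' (f' n)) (mdist_sym y (g n))
  (mdist_sym y' (g' n)).
by move: h5 h6 h8; move: n.+1%:R^-1 => q *; split; lra.
Qed.

(** [phi x] is the limit along [U] of the partners of [x], which stay in a compact ball; it
    preserves distances because the distortions tend to 0. *)
Lemma approx_isometric (R : realType) (X Y : pmetricSpace R) :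
  bcompact X -> bcompact Y ->
  (forall n : nat, approx X Y n%:R n%:R n.+1%:R^-1) -> pointed_isometric X Y.
Proof.
move=> cX cY /choice[C HC].
have [U UU Uoo] := exists_nat_ultrafilter.
have inv1 n : n.+1%:R^-1 <= 1 :> R by rewrite invf_le1 ?ler1n ?ltr0n.
have far (c : R) : U [set n | c <= n%:R].
  apply: filterS (Uoo (Num.truncn c).+1) => n /= Hn.
  apply/ltW/(lt_le_trans (truncnS_gt _)).
  by rewrite ler_nat.
(* The base point is a default for the [n] whose ball misses [x]; [U] ignores those. *)
have [f Hf] : exists f : X -> nat -> Y, forall x n,
    mdist (pt X) x <= n%:R -> C n x (f x n).
  apply: (@ex_choice _ _ (fun x fx => forall n, mdist (pt X) x <= n%:R -> C n x (fx n))) => x.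
  apply: (@ex_choice _ _ (fun n y => mdist (pt X) x <= n%:R -> C n x y)) => n.
  have [xn|nxn] := pselect (mdist (pt X) x <= n%:R); last by exists (pt Y).
  by have [_ /(_ _ xn)[y Cxy] _ _] := HC n; exists y.
have [g Hg] : exists g : Y -> nat -> X, forall y n,
    mdist (pt Y) y <= n%:R -> C n (g y n) y.
  apply: (@ex_choice _ _ (fun y gy => forall n, mdist (pt Y) y <= n%:R -> C n (gy n) y)) => y.
  apply: (@ex_choice _ _ (fun n x => mdist (pt Y) y <= n%:R -> C n x y)) => n.
  have [yn|nyn] := pselect (mdist (pt Y) y <= n%:R); last by exists (pt X).
  by have [_ _ /(_ _ yn)[x Cxy] _] := HC n; exists x.
have UCf x : U [set n | C n x (f x n)].
  by apply: filterS (far (mdist (pt X) x)) => n /Hf.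
have UCg y : U [set n | C n (g y n) y].
  by apply: filterS (far (mdist (pt Y) y)) => n /Hg.
have [phi Hphi] : exists phi : X -> Y, forall x, ulim U (f x) (phi x).
  apply: (@ex_choice _ _ (fun x => ulim U (f x))) => x.
  have [||y _ ?] := @mcompact_ulim _ _ U _ (cball (pt Y) (mdist (pt X) x + 1)) (f x).
    exact: cY.
    apply: filterS (UCf x) => n /= Cn; have [Coo _ _ Cd] := HC n.
    have [_] := Cd _ _ _ _ Coo Cn; rewrite /cball/=.
    by move: (inv1 n); move: n.+1%:R^-1 => q; lra.
  by exists y.
have distU (x x' : nat -> X) (y y' : nat -> Y) :
    U [set n | C n (x n) (y n)] -> U [set n | C n (x' n) (y' n)] ->
    U [set n | mdist (x n) (x' n) <= mdist (y n) (y' n) + n.+1%:R^-1 /\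
               mdist (y n) (y' n) <= mdist (x n) (x' n) + n.+1%:R^-1].
  move=> H H'; apply: filterS2 H H' => n /= Cn Cn'.
  by have [_ _ _ Cd] := HC n; exact: Cd Cn Cn'.
exists phi; split.
- move=> x x'; apply/esym.
  apply: (@ulim_dist_eq _ U _ _ (fun=> x) (fun=> x') (f x) (f x')) => //;
    [exact: ulim_const|exact: ulim_const|exact: distU].
- move=> y.
  have [||x _ Hx] := @mcompact_ulim _ _ U _ (cball (pt X) (mdist (pt Y) y + 1)) (g y).
    exact: cX.
    apply: filterS (UCg y) => n /= Cn; have [Coo _ _ Cd] := HC n.
    have [+ _] := Cd _ _ _ _ Coo Cn; rewrite /cball/=.
    by move: (inv1 n); move: n.+1%:R^-1 => q; lra.
  (* The partners [g y n] of [y] tend to [x] and the partners [f x n] of [x] to [phi x], so the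
     distance from [phi x] to [y] equals that from [x] to [x]. *)
  exists x; apply: mdist_sep; rewrite -(mdist_self x); apply/esym.
  apply: (@ulim_dist_eq _ U _ _ (fun=> x) (g y) (f x) (fun=> y)) => //;
    [exact: ulim_const|exact: ulim_const|exact: distU].
- apply: mdist_sep; rewrite -(mdist_self (pt X)); apply/esym.
  apply: (@ulim_dist_eq _ U _ _ (fun=> pt X) (fun=> pt X) (f (pt X)) (fun=> pt Y)) => //;
    try exact: ulim_const.
  by apply: distU => //; apply: filterE => n; have [] := HC n.
Qed.

Lemma pointed_isometric_approx (R : realType) (X Y : pmetricSpace R) (r s : R) :
  pointed_isometric X Y -> approx X Y r s 0.
Proof.
move=> [phi [phid phis phio]]; exists (fun x y => phi x = y); split=> //.
- by move=> x _; exists (phi x).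
- by move=> x y x' y' <- <-; rewrite phid addr0.
Qed.

Lemma dGH_eq0 (R : realType) (X Y : pmetricSpace R) :
  bcompact X -> bcompact Y -> dGH X Y = 0 <-> pointed_isometric X Y.
Proof.
move=> cX cY; split=> [d0|iXY].
  (* For this [e], the smaller radius [e^-1 - e] is at least [n] and the distortion is below
     [n.+1%:R^-1]. *)
  apply: approx_isometric => // n; pose e : R := n.+2%:R^-1.
  have e0 : 0 < e by rewrite invr_gt0.
  have e1 : e <= 1 by rewrite invf_le1 ?ler1n.
  have [//||d de ap] := dGH_lt_approx cX cY (e := e); first by rewrite d0.
  have ei : e^-1 = n%:R + 2 by rewrite /e invrK -natrD addn2.
  apply: approxW ap; rewrite ?ei; try by move: e e1 {e0 de ei} => e; lra.
  by apply/ltW/(lt_le_trans de); rewrite /e lef_pV2 ?posrE// ler_nat.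
apply/eqP; rewrite eq_le dGH_ge0 andbT; apply/ler_addgt0Pr => t t0.
rewrite add0r; have [/ltW t1|t1] := ltP 1 t; first exact: le_trans (dGH_le1 _ _) _.
by apply: (approx_dGH_le_balanced cX cY t0 t1 t0); exact: pointed_isometric_approx.
Qed.

(** * Completion and ultralimits *)

(** Completeness is stated for Cauchy ultrafilters instead of sequences, to combine directly with
    [ulim_mcompact]. *)
Definition ultracomplete (R : realType) (T : metricSpace R) :=
  forall F : set_system T, UltraFilter F ->
    (forall e : R, 0 < e -> exists b, F [set q | mdist q b <= e]) ->
    exists q, ulim F id q.

(* Kuratowski embedding [z |-> rho z _]: the completion is the uniform closure
   of its image, and Cauchy ultrafilters converge pointwise. *)
Lemma pseudometric_completion (R : realType) (S : Type) (rho : S -> S -> R) :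
  (forall z, rho z z = 0) -> (forall z w, rho z w = rho w z) ->
  (forall u v w, rho u w <= rho u v + rho v w) ->
  exists (T : metricSpace R) (iota : S -> T),
    [/\ forall z w, mdist (iota z) (iota w) = rho z w,
        forall p e, 0 < e -> exists z, mdist p (iota z) <= e &
        ultracomplete T].
Proof.
move=> rho0 rhoC rhoT.
pose P (phi : S -> R) :=
  forall e, 0 < e -> exists z, forall w, `|phi w - rho z w| <= e.
pose K := {phi : S -> R | P phi}.
pose D (p q : K) := [set `|sval p w - sval q w| | w in [set: S]].
pose dist (p q : K) := sup (D p q).
have Dn0 p q : D p q !=set0.
  by have [z _] := svalP p 1 ltr01; exists `|sval p z - sval q z|, z.
have Dub p q : has_ubound (D p q).
  have [z Hz] := svalP p 1 ltr01; have [z' Hz'] := svalP q 1 ltr01.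
  exists (rho z z' + 2) => _ [w _ <-]; move: (Hz w) (Hz' w).
  have := rhoT z z' w; have := rhoT z' z w; rewrite (rhoC z' z).
  by rewrite !ler_norml => ? ? /andP[? ?] /andP[? ?]; apply/andP; split; lra.
have distP p q c : dist p q <= c <-> forall w, `|sval p w - sval q w| <= c.
  split=> [H w|H]; last by apply: ge_sup => // _ [w _ <-].
  by apply: le_trans H; apply: ub_le_sup => //; exists w.
have dist_ge p q w : `|sval p w - sval q w| <= dist p q.
  exact: (distP p q _).1 (lexx _) w.
have dist0 p : dist p p = 0.
  apply/eqP; rewrite eq_le; apply/andP; split.
    by apply/distP => w; rewrite subrr normr0.
  by have [w _] := svalP p 1 ltr01; apply: le_trans (dist_ge p p w).
have distC p q : dist p q = dist q p.
  by apply/eqP; rewrite eq_le; apply/andP; split; apply/distP => w; rewrite distrC.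
have distT p q u : dist p u <= dist p q + dist q u.
  apply/distP => w; apply: le_trans (lerD (dist_ge p q w) (dist_ge q u w)).
  exact: ler_distD.
have dist_sep p q : dist p q = 0 -> p = q.
  move=> pq; have : sval p = sval q.
    by apply/funext => w; apply/eqP; rewrite -subr_eq0 -normr_le0 -pq.
  by case: p q {pq} => [p Pp] [q Pq] /= E; exact: eq_exist.
pose T := MetricSpace dist0 distC distT dist_sep.
have Piota z : P (rho z).
  by move=> e e0; exists z => w; rewrite subrr normr0 ltW.
pose iota z : K := exist _ (rho z) (Piota z).
exists T, iota; split.
- move=> z w; apply/eqP; rewrite eq_le; apply/andP; split.
    apply/distP => v /=; rewrite ler_norml.
    have := rhoT z w v; have := rhoT w z v; rewrite (rhoC w z) => ? ?.
    by apply/andP; split; lra.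
  have := dist_ge (iota z) (iota w) w; rewrite /= rho0 subr0.
  exact: le_trans (ler_norm _).
- move=> p e e0; have [z Hz] := svalP p e e0; exists z.
  exact/distP.
- move=> F UF Fb.
  have [phi Hphi] : exists phi : S -> R, forall w,
      forall e, 0 < e -> F [set q : K | `|sval q w - phi w| < e].
    apply: (@ex_choice _ _ (fun w l => forall e : R, 0 < e ->
      F [set q : K | `|sval q w - l| < e])) => w.
    have [b Hb] := Fb _ ltr01.
    apply: (@ultra_real_cvg _ _ F (fun q : K => sval q w) (`|sval b w| + 1)) => //.
    apply: filterS Hb => q /= qb; have := dist_ge q b w => qbw.
    rewrite -[sval q w](subrK (sval b w)) addrC (le_trans (ler_normD _ _))//.
    by rewrite lerD2l (le_trans qbw).
  (* A bound uniform in [w] survives the pointwise limit; this yields both that [phi] belongs to [K]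
     and that [F] converges to it. *)
  have phib e b : F [set q : T | mdist q b <= e] -> forall w, `|phi w - sval b w| <= e.
    move=> He w; apply/ler_addgt0Pr => t t0.
    have [q [/= qb qp]] := filter_ex (filterI He (Hphi w t t0)).
    have := le_trans (dist_ge q b w) qb.
    have := ler_distD (sval q w) (phi w) (sval b w).
    by rewrite (distrC (phi w) (sval q w)); lra.
  have Pphi : P phi.
    move=> e e0; have [|b Hb] := Fb (e / 2); first lra.
    have [|z Hz] := svalP b (e / 2); first lra.
    exists z => w; have := phib _ _ Hb w; have := Hz w.
    by have := ler_distD (sval b w) (phi w) (rho z w); lra.
  exists (exist _ phi Pphi : K) => e e0.
  have [|b Hb] := Fb (e / 3); first lra.
  apply: filterS (Hb) => q /= qb.
  have : dist b (exist _ phi Pphi) <= e / 3.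
    by rewrite distC; apply/distP => w; exact: phib.
  by have := distT q b (exist _ phi Pphi); rewrite /=; lra.
Qed.

(** Boundedness keeps limits of distances along an ultrafilter finite. *)
Definition bseq (R : realType) (Xs : nat -> pmetricSpace R) :=
  {z : forall n, Xs n | exists M : R, forall n, mdist (pt (Xs n)) (z n) <= M}.

(** Only density of the image of [iota] is required, since [T] will be a completion. *)
Definition is_ultralimit (R : realType) (U : set_system nat)
    (Xs : nat -> pmetricSpace R) (T : pmetricSpace R) (iota : bseq Xs -> T) :=
  [/\ exists2 z, forall n, sval z n = pt (Xs n) & iota z = pt T,
      forall z w (e : R), 0 < e -> U [set n |
        `|mdist (sval z n) (sval w n) - mdist (iota z) (iota w)| < e] &
      forall p (e : R), 0 < e -> exists z, mdist p (iota z) <= e].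

Lemma exists_ultralimit (R : realType) (U : set_system nat)
    (Xs : nat -> pmetricSpace R) :
  UltraFilter U -> exists (T : pmetricSpace R) (iota : bseq Xs -> T),
    is_ultralimit U iota /\ ultracomplete T.
Proof.
move=> UU.
have [rho Hrho] : exists rho : bseq Xs * bseq Xs -> R, forall zw (e : R), 0 < e ->
    U [set n | `|mdist (sval zw.1 n) (sval zw.2 n) - rho zw| < e].
  apply: (@ex_choice _ _ (fun zw l => forall e : R, 0 < e ->
    U [set n | `|mdist (sval zw.1 n) (sval zw.2 n) - l| < e])) => -[z w] /=.
  have [Mz Hz] := svalP z; have [Mw Hw] := svalP w.
  apply: (@ultra_real_cvg _ _ U _ (Mz + Mw)).
  apply: filterE => n /=; rewrite ger0_norm ?mdist_ge0//.
  have := mdist_tri (sval z n) (pt (Xs n)) (sval w n).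
  by rewrite (mdist_sym (sval z n) (pt _)); have := Hz n; have := Hw n; lra.
(* At one common index three distances are close to their limits, so [rho] inherits the pseudometric
   axioms. *)
have U3 (z w u : bseq Xs) (e : R) : 0 < e -> exists n,
    [/\ `|mdist (sval z n) (sval w n) - rho (z, w)| < e,
        `|mdist (sval w n) (sval u n) - rho (w, u)| < e &
        `|mdist (sval z n) (sval u n) - rho (z, u)| < e].
  move=> e0; have [n [[h1 h2] h3]] := filter_ex (filterI (filterI
    (Hrho (z, w) e e0) (Hrho (w, u) e e0)) (Hrho (z, u) e e0)).
  by exists n.
have rho0 z : rho (z, z) = 0.
  apply/eqP; rewrite -normr_le0; apply/ler_addgt0Pr => e e0.
  have [n [+ _ _]] := U3 z z z e e0; rewrite mdist_self sub0r normrN; lra.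
have rhoT u v w : rho (u, w) <= rho (u, v) + rho (v, w).
  apply/ler_addgt0Pr => e e0; have [|n []] := U3 u v w (e / 3); first lra.
  rewrite !ltr_norml => /andP[? ?] /andP[? ?] /andP[? ?].
  by have := mdist_tri (sval u n) (sval v n) (sval w n); lra.
have rhoC z w : rho (z, w) = rho (w, z).
  suff H u v : rho (u, v) <= rho (v, u) by apply/eqP; rewrite eq_le !H.
  apply/ler_addgt0Pr => e e0; have [|n []] := U3 u v u (e / 2); first lra.
  rewrite !ltr_norml => /andP[? ?] /andP[? ?] _.
  by have := mdist_sym (sval u n) (sval v n); lra.
have [T [iota [iotad iotaD cT]]] :=
  @pseudometric_completion R _ (fun z w => rho (z, w)) rho0 rhoC rhoT.
have z0P : exists M : R, forall n, mdist (pt (Xs n)) (pt (Xs n)) <= M.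
  by exists 0 => n; rewrite mdist_self.
pose z0 : bseq Xs := exist _ (fun n => pt (Xs n)) z0P.
exists (PMetricSpace (iota z0)), iota; split=> //; split=> //; first by exists z0.
by move=> z w e e0 /=; rewrite iotad; exact: Hrho (z, w) e e0.
Qed.

(** The relations [C n] are carried to the limit, thickened on both sides: [iota] has only dense
    image, and the partners in [X] of the terms of a sequence vary with [n], converging only along
    [U]. *)
Lemma ultralimit_approx (R : realType) (U : set_system nat)
    (Xs : nat -> pmetricSpace R) (T X : pmetricSpace R) (iota : bseq Xs -> T)
    (r s d t : R) :
  UltraFilter U -> is_ultralimit U iota -> bcompact X -> 0 < t ->
  U [set n | approx X (Xs n) r s d] -> approx X T r (s - t) (d + t).
Proof.
move=> UU [[z0 z0E iz0] Uiota iotaD] cX t0 UA.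
(* The distortion estimate makes five errors of size [t / 8], the radius estimate two. *)
have t8 : 0 < t / 8 by lra.
have d0 : 0 <= d by have [n] := filter_ex UA; exact: approx_ge0.
have [C HC] : exists C : forall n, X -> Xs n -> Prop, forall n,
    approx X (Xs n) r s d ->
    [/\ C n (pt X) (pt (Xs n)),
        forall x, cball (pt X) r x -> exists y, C n x y,
        forall y, cball (pt (Xs n)) s y -> exists x, C n x y &
        distortion_le (C n) d].
  apply: (@ex_choice _ (fun n => X -> Xs n -> Prop) (fun n C =>
    approx X (Xs n) r s d -> [/\ C (pt X) (pt (Xs n)),
        forall x, cball (pt X) r x -> exists y, C x y,
        forall y, cball (pt (Xs n)) s y -> exists x, C x y &
        distortion_le C d])) => n.
  have [[C HC]|nA] := pselect (approx X (Xs n) r s d); first by exists C.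
  by exists (fun _ _ => True).
exists (fun x p => exists2 z : bseq Xs, mdist p (iota z) <= t / 8 &
  U [set n | exists2 x', mdist x x' <= t / 8 & C n x' (sval z n)]); split.
- exists z0; first by rewrite iz0 mdist_self ltW.
  apply: filterS UA => n /= /HC[Coo _ _ _]; exists (pt X).
    by rewrite mdist_self ltW.
  by rewrite z0E.
- move=> x xr.
  have [z Hz] : exists z : forall n, Xs n, forall n,
      mdist (pt (Xs n)) (z n) <= mdist (pt X) x + d /\
      (approx X (Xs n) r s d -> C n x (z n)).
    apply: (@ex_choice _ (fun n => Xs n) (fun n y =>
      mdist (pt (Xs n)) y <= mdist (pt X) x + d /\
      (approx X (Xs n) r s d -> C n x y))) => n.
    have [A|nA] := pselect (approx X (Xs n) r s d).
      have [Coo Cl _ Cd] := HC n A; have [y Cxy] := Cl _ xr.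
      by exists y; split=> //; have [_] := Cd _ _ _ _ Coo Cxy.
    by exists (pt (Xs n)); rewrite mdist_self addr_ge0// mdist_ge0.
  have zP : exists M : R, forall n, mdist (pt (Xs n)) (z n) <= M.
    by exists (mdist (pt X) x + d) => n; have [] := Hz n.
  exists (iota (exist _ z zP)), (exist _ z zP); first by rewrite mdist_self ltW.
  apply: filterS UA => n /= A; exists x; first by rewrite mdist_self ltW.
  by have [_] := Hz n; exact.
- move=> p ps; have [z Hz] := iotaD p _ t8.
  have UB : U [set n | approx X (Xs n) r s d /\ mdist (pt (Xs n)) (sval z n) <= s].
    apply: filterS2 UA (Uiota z0 z _ t8) => n /= A; split=> //.
    move: H; rewrite z0E iz0 ltr_norml => /andP[_ ?].
    have := mdist_tri (pt T) p (iota z); move: ps; rewrite /cball/=; lra.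
  have [x' Hx'] : exists x' : nat -> X, forall n,
      approx X (Xs n) r s d /\ mdist (pt (Xs n)) (sval z n) <= s ->
      C n (x' n) (sval z n).
    apply: (@ex_choice _ _ (fun n x =>
      approx X (Xs n) r s d /\ mdist (pt (Xs n)) (sval z n) <= s ->
      C n x (sval z n))) => n.
    have [[A Hn]|nA] := pselect (approx X (Xs n) r s d /\
      mdist (pt (Xs n)) (sval z n) <= s); last by exists (pt X).
    by have [_ _ Cr _] := HC n A; have [x Cx] := Cr _ Hn; exists x.
  (* The partners [x' n] lie in a fixed compact ball of [X]; their limit [x] is the partner of
     [p]. *)
  have [||x _ Hx] := @mcompact_ulim _ _ U X (cball (pt X) (s + d)) x'.
  + exact: cX.
  + apply: filterS UB => n /= B; have [Coo _ _ Cd] := HC n B.1.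
    have [+ _] := Cd _ _ _ _ Coo (Hx' n B).
    by have := B.2; rewrite /cball/=; lra.
  exists x, z => //; apply: filterS2 UB (Hx _ t8) => n /= B xx'.
  by exists (x' n); [rewrite mdist_sym ltW|exact: Hx'].
- move=> x p y q [z pz Uz] [w qw Uw].
  have [n [[A [x' xx' Cx]] [[y' yy' Cy] zw]]] := filter_ex (filterI (filterI UA Uz)
    (filterI Uw (Uiota z w _ t8))).
  have [_ _ _ Cd] := HC n A; have [h1 h2] := Cd _ _ _ _ Cx Cy.
  move: zw; rewrite /= ltr_norml => /andP[h3 h4].
  have := mdist_tri x x' y; have := mdist_tri x' y' y.
  have := mdist_tri x' x y'; have := mdist_tri x y y'.
  have := mdist_tri p (iota z) q; have := mdist_tri (iota z) (iota w) q.
  have := mdist_tri (iota z) p (iota w); have := mdist_tri p q (iota w).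
  rewrite (mdist_sym x' x) (mdist_sym y' y) (mdist_sym (iota z) p)
    (mdist_sym (iota w) q).
  by move=> *; split; lra.
Qed.

(** * Bounded compactness of the limit and completeness *)

(** Partners in the compact ball of [X] converge along [F] to some [x]. Points whose partners are
    within [e / 2] of [x] are within [d + e] of each other, and [b] is any of them. *)
Lemma approx_ultra_small (R : realType) (X T : pmetricSpace R)
    (F : set_system T) (r s d e : R) :
  UltraFilter F -> bcompact X -> approx X T r s d -> F (cball (pt T) s) ->
  0 < e -> exists b, F [set q | mdist q b <= d + e].
Proof.
move=> UF cX [C [Coo Cl Cr Cd]] Fs e0.
have [g Hg] : exists g : T -> X, forall y, cball (pt T) s y -> C (g y) y.
  apply: (@ex_choice _ _ (fun y x => cball (pt T) s y -> C x y)) => y.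
  have [/Cr[x Cxy]|ny] := pselect (cball (pt T) s y); first by exists x.
  by exists (pt X).
have [||x _ Hx] := @mcompact_ulim _ _ F X (cball (pt X) (s + d)) g.
- exact: cX.
- apply: filterS Fs => y /= ys; have [+ _] := Cd _ _ _ _ Coo (Hg _ ys).
  by move: ys; rewrite /cball/=; lra.
have e2 : 0 < e / 2 by lra.
have FI : F (cball (pt T) s `&` [set y | mdist (g y) x < e / 2]).
  exact: filterI (Hx _ e2).
have [b [bs /= bx]] := filter_ex FI; exists b.
apply: filterS FI => q [qs /= qx].
have [_] := Cd _ _ _ _ (Hg _ qs) (Hg _ bs).
by have := mdist_tri (g q) x (g b); rewrite (mdist_sym x); lra.
Qed.

(** Approximations of arbitrarily small distortion make ultrafilters on a ball Cauchy, and
    completeness makes them converge; the closed ball contains the limit. *)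
Lemma approx_bcompact (R : realType) (T : pmetricSpace R) :
  ultracomplete T ->
  (forall s e : R, 0 < e -> exists (X : pmetricSpace R) (r : R),
     bcompact X /\ approx X T r s e) -> bcompact T.
Proof.
move=> cT H x r; apply: ulim_mcompact => F UF Fr.
have [e e0|q Fq] := cT F UF.
  have [|X [r' [cX ap]]] := H (mdist (pt T) x + r) (e / 2); first lra.
  have [||b Fb] := approx_ultra_small UF cX ap (e := e / 2).
  - apply: filterS Fr => y; rewrite /cball/= => xy.
    by have := mdist_tri (pt T) x y; lra.
  - lra.
  by exists b; apply: filterS Fb => y /=; lra.
exists q => //; rewrite /cball/=; apply/ler_addgt0Pr => e e0.
have [y [/= yr yq]] := filter_ex (filterI Fr (Fq e e0)).
by have := mdist_tri x y q; move: yr; rewrite /cball/=; lra.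
Qed.

Lemma dGH_complete (R : realType) (Xs : nat -> pmetricSpace R) :
  (forall n, bcompact (Xs n)) ->
  (forall e : R, 0 < e -> exists N : nat, forall m n : nat,
     (N <= m)%N -> (N <= n)%N -> dGH (Xs m) (Xs n) < e) ->
  exists X : pmetricSpace R, bcompact X /\
    dGH (Xs n) X @[n --> \oo] --> (0 : R).
Proof.
move=> cXs cauchy.
have [U UU Uoo] := exists_nat_ultrafilter.
have [T [iota [Tlim Tc]]] := @exists_ultralimit R U Xs UU.
(* [Xs m] is fixed and compared with all later [Xs n]; the ultralimit is taken in [n]. *)
have ap e : 0 < e -> e <= 1 -> exists N : nat, forall m, (N <= m)%N ->
    approx (Xs m) T e^-1 (e^-1 - e - e) (e + e).
  move=> e0 e1; have [N HN] := cauchy e e0; exists N => m Nm.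
  apply: (ultralimit_approx UU Tlim (cXs m) e0).
  apply: filterS (Uoo N) => n /= Nn.
  have [d de] := dGH_lt_approx (cXs m) (cXs n) e1 (HN _ _ Nm Nn).
  by apply: approxW => //; exact: ltW.
have bT : bcompact T.
  apply: approx_bcompact => // s e e0.
  (* Then [a + a <= e] and [s <= a^-1 - a - a]; the absolute value allows for negative [s]. *)
  pose a := Num.min (Num.min 1 (e / 2)) (`|s| + 2)^-1.
  have s0 : 0 < `|s| + 2 by have := normr_ge0 s; lra.
  have a0 : 0 < a by rewrite !lt_min ltr01 invr_gt0 s0 divr_gt0.
  have [a1 [ae as_]] : a <= 1 /\ a <= e / 2 /\ a <= (`|s| + 2)^-1.
    by rewrite /a !ge_min !lexx !orbT.
  have si : `|s| + 2 <= a^-1 by rewrite -[_ + 2]invrK lef_pV2 ?posrE ?invr_gt0.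
  have [N /(_ _ (leqnn N)) apN] := ap a a0 a1.
  exists (Xs N), a^-1; split=> //.
  by have := ler_norm s; move=> ?; apply: approxW apN => //; lra.
exists T; split=> //; apply/cvg0_nonneg => [n|e e0]; first exact: dGH_ge0.
pose a := Num.min 1 (e / 2).
have [a0 [a1 ae]] : 0 < a /\ a <= 1 /\ a < e.
  rewrite /a lt_min ltr01 divr_gt0// ge_min lexx; do 2!split=> //.
  by rewrite gt_min; apply/orP; right; lra.
(* At scale [a / 4] both radii exceed [a^-1], while the distortion [a / 2] is below [a]. *)
have [||N HN] := ap (a / 4); try lra.
exists N => n /HN apn; apply: le_lt_trans ae.
apply: (@approx_dGH_le_balanced _ _ _ _ (a / 4 + a / 4)) => //; first lra.
have ai : 1 <= a^-1 by rewrite invf_ge1.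
have aE : (a / 4)^-1 = 4 * a^-1 by rewrite invfM invrK mulrC.
by apply: approxW apn => //; rewrite aE; lra.
Qed.

(** * Separability *)

(** Distances are rounded down in units of [1 / n], so that codes form a countable type. *)
Definition net_code (R : realType) (X : pmetricSpace R) (n : nat) (s : seq X) :
    seq (seq nat) :=
  [seq [seq Num.truncn (n%:R * mdist a b) | b <- s] | a <- s].

(** The base point is placed at index 0, so that equal codes match the base points. *)
Definition has_code (R : realType) (X : pmetricSpace R) (n : nat)
    (c : seq (seq nat)) :=
  exists s : seq X, (forall x, cball (pt X) n%:R x ->
      exists a, List.In a s /\ n%:R * mdist a x <= 1) /\
    net_code n (pt X :: s) = c.

Lemma net_code_nth (R : realType) (X : pmetricSpace R) (n : nat) (s : seq X)
    (i j : nat) :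
  (i < size s)%N -> (j < size s)%N ->
  nth 0%N (nth [::] (net_code n s) i) j =
  Num.truncn (n%:R * mdist (nth (pt X) s i) (nth (pt X) s j)).
Proof. by move=> si sj; rewrite (nth_map (pt X))// (nth_map (pt X)). Qed.

Lemma In_nth (A : Type) (x0 a : A) (s : seq A) :
  List.In a s -> exists2 i, (i < size s)%N & nth x0 s i = a.
Proof.
elim: s => //= b s IH [->|/IH[i si sa]]; first by exists 0%N.
by exists i.+1.
Qed.

Lemma truncn_eq_dist (R : realType) (u v : R) :
  0 <= u -> 0 <= v -> Num.truncn u = Num.truncn v -> u <= v + 1.
Proof.
move=> u0 v0 uv; have := truncnS_gt u; rewrite uv -natr1.
by have : (Num.truncn v)%:R <= v by [rewrite truncn_le]; lra.
Qed.

(** Points near net points of equal index are related. In units of [1 / n], moving to the net and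
    back costs 4 and rounding costs 1. *)
Lemma has_code_approx (R : realType) (X Y : pmetricSpace R) (n : nat)
    (c : seq (seq nat)) :
  (0 < n)%N -> has_code X n c -> has_code Y n c ->
  approx X Y n%:R n%:R (5 / n%:R).
Proof.
move=> n0 [s [sX sc]] [t [tY tc]].
have n0' : 0 < n%:R :> R by rewrite ltr0n.
pose a i := nth (pt X) (pt X :: s) i; pose b i := nth (pt Y) (pt Y :: t) i.
have st : size s = size t.
  by have := congr1 size sc; rewrite -tc !size_map => -[].
have E i j : (i < (size s).+1)%N -> (j < (size s).+1)%N ->
    Num.truncn (n%:R * mdist (a i) (a j)) = Num.truncn (n%:R * mdist (b i) (b j)).
  move=> si sj; have := congr1 (fun c => nth 0%N (nth [::] c i) j) sc.
  by rewrite -tc !net_code_nth //= -st.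
exists (fun x y => exists i, [/\ (i < (size s).+1)%N,
  n%:R * mdist (a i) x <= 1 & n%:R * mdist (b i) y <= 1]); split.
- by exists 0%N; rewrite /a /b /= !mdist_self mulr0.
- move=> x /sX[z [/(In_nth (pt X))[i si <-] zx]]; exists (b i.+1), i.+1.
  by split=> //; rewrite mdist_self mulr0.
- move=> y /tY[z [/(In_nth (pt Y))[i ti <-] zy]]; exists (a i.+1), i.+1.
  by split=> //; rewrite ?mdist_self ?mulr0// ltnS st.
move=> x y x' y' [i [si ix iy]] [j [sj jx jy]].
have pos (Z : metricSpace R) (u v : Z) : 0 <= n%:R * mdist u v.
  by rewrite mulr_ge0 ?mdist_ge0// ltW.
have h1 := truncn_eq_dist (pos _ _ _) (pos _ _ _) (E i j si sj).
have h2 := truncn_eq_dist (pos _ _ _) (pos _ _ _) (esym (E i j si sj)).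
have tri (Z : metricSpace R) (u v w : Z) :
    n%:R * mdist u w <= n%:R * mdist u v + n%:R * mdist v w.
  by rewrite -mulrDr ler_pM2l// mdist_tri.
have := tri _ x (a i) x'; have := tri _ (a i) (a j) x'.
have := tri _ y (b i) y'; have := tri _ (b i) (b j) y'.
have := tri _ (a i) x (a j); have := tri _ x x' (a j).
have := tri _ (b i) y (b j); have := tri _ y y' (b j).
rewrite (mdist_sym x (a i)) (mdist_sym y (b i)) (mdist_sym x' (a j))
  (mdist_sym y' (b j)) => *.
by split; rewrite -(ler_pM2l n0') mulrDr mulrCA divff ?gt_eqF// mulr1; lra.
Qed.

Lemma exists_code (R : realType) (X : pmetricSpace R) (n : nat) :
  bcompact X -> (0 < n)%N -> exists c, has_code X n c.
Proof.
move=> cX n0; have n0' : 0 < n%:R :> R by rewrite ltr0n.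
have [|s sX] := @mcompact_net _ _ (cball (pt X) n%:R) n%:R^-1 (cX _ _).
  by rewrite invr_gt0.
exists (net_code n (pt X :: s)), s; split=> // x /sX[a [sa ax]]; exists a.
by split=> //; rewrite mulrC -ler_pdivlMr// div1r ltW.
Qed.

(** The one-point space, a default value for the dense sequence. *)
Lemma exists_bcompact (R : realType) : exists X : pmetricSpace R, bcompact X.
Proof.
pose d (x y : unit) : R := 0.
have dsep x y : d x y = 0 -> x = y by case: x y => -[].
have dtri x y z : d x z <= d x y + d y z by rewrite addr0.
exists (PMetricSpace (pms := @MetricSpace R unit d (fun=> erefl)
  (fun _ _ => erefl) dtri dsep) tt) => x r I U oU KU.
have [r0|r0] := leP 0 r; last by exists [::] => y; rewrite /cball /= leNgt r0.
have [|i Ui] := KU tt; first by case: x {KU}.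
by exists [:: i] => -[] _; exists i; split=> //; left.
Qed.

(* Instead of constructing finite rational spaces, pick for every code some
   boundedly compact space that has it. *)
Lemma dGH_separable (R : realType) :
  exists D : nat -> pmetricSpace R, (forall n, bcompact (D n)) /\
    forall X : pmetricSpace R, bcompact X ->
      forall e : R, 0 < e -> exists n, dGH (D n) X < e.
Proof.
have [X0 cX0] := exists_bcompact R.
have [D HD] : exists D : nat * seq (seq nat) -> pmetricSpace R, forall p,
    bcompact (D p) /\ ((exists2 X : pmetricSpace R, bcompact X & has_code X p.1 p.2) ->
      has_code (D p) p.1 p.2).
  apply: (@ex_choice (nat * seq (seq nat)) (fun=> pmetricSpace R)
    (fun p Y => bcompact Y /\
    ((exists2 X : pmetricSpace R, bcompact X & has_code X p.1 p.2) ->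
      has_code Y p.1 p.2))) => p.
  have [[X cX Xp]|nX] :=
    pselect (exists2 X : pmetricSpace R, bcompact X & has_code X p.1 p.2).
    by exists X.
  by exists X0.
exists (fun k => if unpickle k is Some p then D p else X0); split.
  by move=> k; case: unpickle => // p; have [] := HD p.
move=> X cX e e0; pose a := Num.min 1 (e / 2).
have [a0 [a1 ae]] : 0 < a /\ a <= 1 /\ a < e.
  rewrite /a lt_min ltr01 divr_gt0// ge_min lexx; do 2!split=> //.
  by rewrite gt_min; apply/orP; right; lra.
(* [5 / a < n] gives both the distortion [5 / n < a] and the radius [a^-1 <= n]. *)
pose n := (Num.truncn (5 / a)).+1.
have n0' : 0 < n%:R :> R by rewrite ltr0n.
have na : 5 / a < n%:R by exact: truncnS_gt.
have ai : 0 < a^-1 by rewrite invr_gt0.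
have [c Xc] := exists_code (n := n) cX isT.
exists (pickle (n, c)); rewrite pickleK.
have [cD /= HDc] := HD (n, c).
apply: le_lt_trans ae.
apply: (@approx_dGH_le_balanced _ _ _ _ (5 / n%:R)) => //.
  by rewrite ltr_pdivrMr// mulrC -ltr_pdivrMr.
have Dc : has_code (D (n, c)) n c by apply: HDc; exists X.
by apply: approxW (has_code_approx _ Dc Xc) => //; lra.
Qed.

Theorem theorem4p1 (R : realType) :
  (* d_GH metrizes Gromov-Hausdorff convergence *)
  (forall (Xs : nat -> pmetricSpace R) (X : pmetricSpace R),
     (forall n, bcompact (Xs n)) -> bcompact X ->
     (dGH (Xs n) X @[n --> \oo] --> (0 : R) <-> GH_converges Xs X)) /\
  (* d_GH is a metric on pointed-isometry classes *)
  (forall X Y : pmetricSpace R, bcompact X -> bcompact Y ->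
     0 <= dGH X Y /\ dGH X Y = dGH Y X /\
     (dGH X Y = 0 <-> pointed_isometric X Y)) /\
  (forall X Y W : pmetricSpace R, bcompact X -> bcompact Y -> bcompact W ->
     dGH X W <= dGH X Y + dGH Y W) /\
  (* completeness *)
  (forall Xs : nat -> pmetricSpace R, (forall n, bcompact (Xs n)) ->
     (forall e : R, 0 < e -> exists N : nat, forall m n : nat,
        (N <= m)%N -> (N <= n)%N -> dGH (Xs m) (Xs n) < e) ->
     exists X : pmetricSpace R, bcompact X /\
       dGH (Xs n) X @[n --> \oo] --> (0 : R)) /\
  (* separability *)
  (exists D : nat -> pmetricSpace R, (forall n, bcompact (D n)) /\
     forall X : pmetricSpace R, bcompact X ->
       forall e : R, 0 < e -> exists n, dGH (D n) X < e).
Proof.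
split; first exact: dGH_cvg.
split.
  move=> X Y cX cY; split; first exact: dGH_ge0.
  by split; [exact: dGH_sym|exact: dGH_eq0].
split; first exact: dGH_triangle.
by split; [exact: dGH_complete|exact: dGH_separable].
Qed.
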